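(* Let $\varphi$ be an admissible comparison function that is unbounded, let $W=\varphi\circ h$, and let $f\in C(A)$. The following are equivalent: (i) $\|[f]\|^{\sharp}_{\infty,h;\varphi}<\infty$; (ii) there is $L\in\mathbb{R}$ with $\sup_{A}W|f-L|<\infty$; (iii) $L:=\lim_{a\to\omega_A}f(a)$ exists in $\mathbb{R}$ and $W(f-L)$ is bounded on $A$. In that case $L$ is unique, and $$\|f\|_{\infty,h;\varphi;c}=+\infty\quad\text{for every }c\in\mathbb{R},\ c\neq L,\qquad \|[f]\|^{\sharp}_{\infty,h;\varphi}=\|f\|_{\infty,h;\varphi;L}.$$ In particular the infimum over $c$ defining $\|[f]\|^{\sharp}_{\infty,h;\varphi}$ is attained, at the single point $c=L$.
   Context: $A$ is a non-compact, locally compact, $\sigma$-compact Hausdorff space; $h:A\to[0,\infty)$ is a fixed continuous proper exhaustion function, i.e. $h$ is continuous and $h^{-1}([0,R])$ is compact for every $R<\infty$. $C(A)$ is the space of real continuous functions on $A$. An admissible comparison function is a function $\varphi:[0,\infty)\to[1,\infty)$ such that (A1) $\varphi$ is continuous, non-decreasing and $\varphi(0)=1$; (A2) there is $K\ge1$ with $\varphi(r+s)\le K\varphi(r)\varphi(s)$ for all $r,s\ge0$. It is unbounded if $\varphi(t)\to\infty$ as $t\to\infty$. For $f\in C(A)$ and $c\in\mathbb{R}$: $\|f\|_{\infty,h;\varphi;c}:=\sup_{a\in A}W(a)|f(a)-c|\in[0,\infty]$ and $\|[f]\|^{\sharp}_{\infty,h;\varphi}:=\inf_{c\in\mathbb{R}}\|f\|_{\infty,h;\varphi;c}$,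 where $[f]$ is the class of $f$ in $C(A)/\mathbb{R}$ (modulo constant functions). $\lim_{a\to\omega_A}f(a)=L$ means: for every $\varepsilon>0$ there is $R$ such that $|f(a)-L|<\varepsilon$ whenever $h(a)>R$. *)

(* Defs.v *)
From HB Require Import structures.
From mathcomp Require Import all_boot all_order all_algebra.
From mathcomp Require Import all_classical all_reals all_analysis.
Import Order.TTheory GRing.Theory Num.Theory numFieldNormedType.Exports.

Set Implicit Arguments.
Unset Strict Implicit.
Unset Printing Implicit Defensive.

Local Open Scope classical_set_scope.
Local Open Scope ring_scope.

Definition sigma_compact (T : topologicalType) : Prop :=
  exists K : nat -> set T,
    (forall n, compact (K n)) /\ \bigcup_n K n = [set: T].

Record exhaustion (R : realType) (A : topologicalType) (h : A -> R) : Prop := {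
  exhaustion_ge0 : forall a, 0 <= h a;
  exhaustion_continuous : continuous h;
  exhaustion_proper : forall r : R, compact (h @^-1` `[0, r]) }.

(* A comparison function [0, oo[ -> [1, oo[ is represented by a total function
   on R of which only the values on [0, oo[ are constrained (and used). *)
Record admissible (R : realType) (phi : R -> R) : Prop := {
  admissible_ge1 : forall t, 0 <= t -> 1 <= phi t;
  admissible_continuous : {within `[0, +oo[, continuous phi};
  admissible_nondecreasing : forall s t, 0 <= s -> s <= t -> phi s <= phi t;
  admissible0 : phi 0 = 1;
  admissible_submul : exists2 K : R, 1 <= K &
    forall r s, 0 <= r -> 0 <= s -> phi (r + s) <= K * phi r * phi s }.

(* The end omega_A of A: the filter generated by the sets {h > r}. *)
Definition omega_end (R : realType) (A : topologicalType) (h : A -> R) :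
    set_system A :=
  filter_from [set: R] (fun r => [set a | r < h a]).

Lemma cvg_omega_endP (R : realType) (A : topologicalType) (h f : A -> R)
    (L : R) :
  f @ omega_end h --> L <->
  forall e, 0 < e -> exists r, forall a, r < h a -> `|f a - L| < e.
Proof.
split=> [fL e e0|fL].
- have [r _ hr] := fL _ (nbhsx_ballx L e e0).
  by exists r => a /hr; rewrite /ball /= distrC.
- move=> P /nbhs_ballP[e /= e0 eP]; have [r hr] := fL e e0.
  exists r => // a /hr fa; apply: eP.
  by rewrite /ball /= distrC.
Qed.

(* For A empty this is -oo rather than 0; a non-compact A is not empty. *)
Definition wnorm (R : realType) (A : topologicalType) (h : A -> R)
    (phi : R -> R) (f : A -> R) (c : R) : \bar R :=
  ereal_sup [set (phi (h a) * `|f a - c|)%:E | a in [set: A]].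

(* The value at the class [f] in C(A)/R, given through a representative f;
   wnorm_sharpD below shows that it depends only on the class. *)
Definition wnorm_sharp (R : realType) (A : topologicalType) (h : A -> R)
    (phi : R -> R) (f : A -> R) : \bar R :=
  ereal_inf [set wnorm h phi f c | c in [set: R]].

Lemma wnorm_sharpD (R : realType) (A : topologicalType) (h : A -> R)
    (phi : R -> R) (f : A -> R) (k : R) :
  wnorm_sharp h phi (fun a => f a + k) = wnorm_sharp h phi f.
Proof.
have E c : wnorm h phi (fun a => f a + k) c = wnorm h phi f (c - k).
  congr ereal_sup; apply: eq_imagel => a _.
  by rewrite opprB addrA addrAC.
congr ereal_inf; apply/seteqP; split=> _ [c _ <-].
- by exists (c - k).
- by exists (c + k) => //; rewrite E addrK.
Qed.

(* Main.v *)
(* If W |f - c| is bounded and W = phi o h tends to infinity at the end of A,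
   then f tends to c there.  As A is not compact, limits at the end are unique,
   so at most one constant c has a finite weighted norm, and the infimum over c
   is the value at that constant. *)
Require Import Defs.
From HB Require Import structures.
From mathcomp Require Import all_boot all_order all_algebra.
From mathcomp Require Import all_classical all_reals all_analysis.
Import Order.TTheory GRing.Theory Num.Theory numFieldNormedType.Exports.

Set Implicit Arguments.
Unset Strict Implicit.
Unset Printing Implicit Defensive.

Local Open Scope classical_set_scope.
Local Open Scope ring_scope.

Section WeightedNorm.
Variables (R : realType) (A : topologicalType).
Implicit Types (h f : A -> R) (phi : R -> R).

(** If some [[set a | r < h a]] were empty, [A] would be the preimage of [[0, r]] under [h], which
    is compact because [h] is proper. This is where non-compactness enters. *)
Lemma omega_end_proper_filter h : exhaustion h -> ~ compact [set: A] ->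
  ProperFilter (omega_end h).
Proof.
move=> [h_ge0 _ h_proper] ncA; apply: filter_from_proper.
- apply: filter_from_filter; first by exists 0.
  move=> r s _ _; exists (Num.max r s) => // a /=.
  by rewrite gt_max => /andP[].
- move=> r _; apply/set0P/eqP => r_max; apply: ncA.
  rewrite (_ : [set: A] = h @^-1` `[0, r]); first exact: h_proper.
  apply/seteqP; split=> // a _ /=; rewrite in_itv /= h_ge0 /= leNgt.
  by apply/negP => ra; move: (r_max) => /seteqP[/(_ a ra)].
Qed.

Lemma wnorm_ltyP h phi f c :
  (wnorm h phi f c < +oo)%E <->
  exists M, forall a, phi (h a) * `|f a - c| <= M.
Proof.
split=> [|[M leM]]; last first.
  apply: le_lt_trans (ltry M); apply: ge_ereal_sup => _ [a _ <-].
  by rewrite lee_fin.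
have le_wnorm a : ((phi (h a) * `|f a - c|)%:E <= wnorm h phi f c)%E.
  by apply: ereal_sup_ubound; exists a.
case: (wnorm h phi f c) le_wnorm => [M leM _| |leNy _] //.
  by exists M => a; rewrite -lee_fin.
(* The value [-oo] leaves no room for a point [a], since a real would lie below [-oo]; any bound,
   such as [0], is then vacuously valid. *)
by exists 0 => a; have := leNy a; rewrite leeNy_eq.
Qed.

Lemma wnorm_lty_bounded h phi f c :
  exhaustion h -> admissible phi ->
  (wnorm h phi f c < +oo)%E <->
  [bounded phi (h a) * (f a - c) | a in [set: A]].
Proof.
move=> [h_ge0 _ _] [phi_ge1 _ _ _ _].
have normE a : `|phi (h a) * (f a - c)| = phi (h a) * `|f a - c|.
  by rewrite normrM ger0_norm// (le_trans ler01)// phi_ge1.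
rewrite wnorm_ltyP; split=> [[M leM]|[M [_ ltM]]].
  exists M; split; first exact: num_real.
  by move=> y My a _ /=; rewrite normE (le_trans (leM a))// ltW.
(* [ltM] gives the bound only for reals strictly above [M], hence [M + 1]. *)
by exists (M + 1) => a; rewrite -normE; apply: ltM => //; rewrite ltrDl.
Qed.

Lemma wnorm_lty_cvg h phi f c :
  exhaustion h -> admissible phi -> phi t @[t --> +oo] --> +oo ->
  (wnorm h phi f c < +oo)%E -> f @ omega_end h --> c.
Proof.
move=> [h_ge0 _ _] [phi_ge1 _ _ _ _] phiy /wnorm_ltyP[M leM].
apply/cvg_omega_endP => e e0.
(* Once the weight exceeds [M / e], the bound [M] on the product is below the weight times [e];
   cancelling the positive weight leaves the error below [e]. *)
have /cvgryPgt/(_ (M / e))[r [_ phi_gt]] := phiy.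
exists r => a /phi_gt; rewrite ltr_pdivrMr// => ltM.
have phi0 : 0 < phi (h a) by rewrite (lt_le_trans ltr01)// phi_ge1.
by rewrite -(ltr_pM2l phi0); apply: le_lt_trans (leM a) ltM.
Qed.

Lemma wnorm_sharp_le h phi f c :
  (wnorm_sharp h phi f <= wnorm h phi f c)%E.
Proof. by apply: ereal_inf_lbound; exists c. Qed.

Lemma wnorm_sharp_ltyP h phi f :
  (wnorm_sharp h phi f < +oo)%E <-> exists c, (wnorm h phi f c < +oo)%E.
Proof.
split=> [/ereal_inf_lt[_ [c _ <-]] ltc|[c]]; first by exists c.
exact/le_lt_trans/wnorm_sharp_le.
Qed.

End WeightedNorm.

Theorem theorem4p6 (R : realType) (A : topologicalType)
    (A_noncompact : ~ compact [set: A])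
    (A_locally_compact : locally_compact [set: A])
    (A_sigma_compact : sigma_compact A)
    (A_hausdorff : hausdorff_space A)
    (h : A -> R) (h_exhaustion : exhaustion h)
    (phi : R -> R) (phi_admissible : admissible phi)
    (phi_unbounded : phi t @[t --> +oo] --> +oo)
    (f : A -> R) (f_continuous : continuous f) :
  [<-> (wnorm_sharp h phi f < +oo)%E;
       exists L : R, (wnorm h phi f L < +oo)%E;
       exists L : R, f @ omega_end h --> L /\
         [bounded phi (h a) * (f a - L) | a in [set: A]] ] /\
  ((wnorm_sharp h phi f < +oo)%E ->
   exists L : R,
     [/\ f @ omega_end h --> L,
         [bounded phi (h a) * (f a - L) | a in [set: A]] &
         (wnorm h phi f L < +oo)%E] /\
     (forall L' : R, f @ omega_end h --> L' -> L' = L) /\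
     (forall L' : R, (wnorm h phi f L' < +oo)%E -> L' = L) /\
     (forall c : R, c <> L -> wnorm h phi f c = +oo%E) /\
     wnorm_sharp h phi f = wnorm h phi f L /\
     (forall c : R, wnorm h phi f c = wnorm_sharp h phi f <-> c = L)).
Proof.
have endF := omega_end_proper_filter h_exhaustion A_noncompact.
have finite_cvg c : (wnorm h phi f c < +oo)%E -> f @ omega_end h --> c.
  exact: wnorm_lty_cvg.
have lim_unique (L L' : R) : f @ omega_end h --> L -> f @ omega_end h --> L' ->
    L' = L.
  (* The image filter is proper because [endF] is, and limits of proper filters in [R] are
     unique. *)
  by move=> fL fL'; apply: (norm_cvg_unique (F := f @ omega_end h)).
split.
  tfae.
  - by move/wnorm_sharp_ltyP.
  - move=> [L finL]; exists L; split; first exact: finite_cvg.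
    exact/wnorm_lty_bounded.
  - move=> [L [_ bndL]]; apply/wnorm_sharp_ltyP; exists L.
    exact/wnorm_lty_bounded.
move=> fin_sharp; have /wnorm_sharp_ltyP[L finL] := fin_sharp.
have fL := finite_cvg _ finL.
have finE c : (wnorm h phi f c < +oo)%E -> c = L.
  by move/finite_cvg; apply: lim_unique.
have infE c : c <> L -> wnorm h phi f c = +oo%E.
  by move=> cL; apply/eqP; rewrite -leye_eq leNgt; apply/negP => /finE.
have sharpE : wnorm_sharp h phi f = wnorm h phi f L.
  apply/eqP; rewrite eq_le wnorm_sharp_le /=.
  apply: le_ereal_inf_tmp => _ [c _ <-].
  (* Every [c] other than [L] contributes [+oo] to the infimum, so the value at [L] is a lower
     bound. *)
  by have [->//|/eqP/infE ->] := eqVneq c L; rewrite leey.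
exists L; split; first by split=> //; apply/wnorm_lty_bounded.
split; first by move=> L'; apply: lim_unique.
do 3!split=> //.
move=> c; split=> [cE|->]; last by rewrite sharpE.
(* A minimiser has finite norm, because the infimum [fin_sharp] is finite, so it must be [L]. *)
by apply: finE; rewrite cE.
Qed.
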